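(* Let $x,y\in\mathcal{L}$ and let $[a,b]$ be a minimal height interval for $x$ and $y$. Then every path $(p,\Gamma)$ associated to $[a,b]$ is a geodesic, i.e. $\mathcal{H}^1(\Gamma)=d(x,y)$.
   Context: Setup. Fix $1<Q<2$ and let $s$ satisfy $\log_s 2=Q-1$ (so $s>2$). Let $I=[0,1]$ and let $\mathcal{F}\subset[0,1]$ be the attractor of the iterated function system $f_0(x)=\frac{x}{s}$, $f_1(x)=\frac{x}{s}+\frac{s-1}{s}$, i.e. the unique nonempty compact set with $\mathcal{F}=f_0(\mathcal{F})\cup f_1(\mathcal{F})$. Each $x\in\mathcal{F}$ is written uniquely as $x=\sum_{i\ge1}(x)_i\frac{s-1}{s^i}$ with digits $(x)_i\in\{0,1\}$. Let $n$ be the integer with $n\le s<n+1$, and fix a sequence $(m_i)_{i\ge1}$ with $m_i\in\{n,n+1\}$ and $\frac{n}{n+1}\prod_{j=1}^i m_j^{-1}\le s^{-i}\le\frac{n+1}{n}\prod_{j=1}^i m_j^{-1}$ for all $i\geq 1$. For $k\ge1$, $J_k\subset(0,1)$ (the wormhole levels of order $k$) is the set of all numbers $\omega_k(n_1,\dots,n_k)=\sum_{j=1}^k n_j\prod_{h=1}^j m_h^{-1}$ with $n_j\in\{0,\dots,m_j-1\}$ for $j<k$ and $n_k\in\{1,\dots,m_k-1\}$; the sets $J_k$ are pairwise disjoint. On $\mathcal{F}\times I$ identify $(x_1,y_1)\sim(x_2,y_2)$ if the points are equal, or if $y_1=y_2\in J_k$ for some $k$ and $x_1,x_2$ differ in exactly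 the $k$-th digit (so $x_1=x_2\pm\frac{s-1}{s^k}$). Let $\pi$ be the quotient map, $[x_1,y_1]=\pi(x_1,y_1)$, and $\mathcal{L}=\pi(\mathcal{F}\times I)$ (the Laakso space) with the quotient topology. The height function is $h([x_1,y_1])=y_1$; $h$ also denotes the projection $\mathcal{F}\times I\to I$. A path joining $x,y\in\mathcal{L}$ is (the image of) a continuous $p:[0,1]\to\mathcal{L}$ with $p(0)=x$, $p(1)=y$. The distance on $\mathcal{L}$ is $d(x,y)=\inf\{\mathcal{H}^1(\Gamma): \Gamma\subset\mathcal{F}\times I,\ \pi(\Gamma)\text{ is a path joining }x\text{ and }y\}$, where $\mathcal{H}^1$ is one-dimensional Hausdorff measure for the Euclidean metric of $\mathbb{R}^2$. Lifted paths. A path with lift $(p,\Gamma)$ is a path $p$ with a set $\Gamma\subset\mathcal{F}\times I$ such that $\pi(\Gamma)=p([0,1])$; its length is $l(p,\Gamma)=\mathcal{H}^1(\Gamma)$. The lifted paths considered are finite concatenations of paths of the following two kinds (and constant paths): (i) a finite list of injective affine maps $\gamma_1,\dots,\gamma_k:[0,1]\to\mathcal{F}\times I$ parametrizing vertical segments $\{x\}\times[c,d]$, with $\gamma_j(1)\ne\gamma_{j+1}(0)$ and $\pi(\gamma_j(1))=\pi(\gamma_{j+1}(0))$; (ii) an infinite sequence $\gamma_1,\gamma_2,\dots$ of such maps whose end points $\gamma_j(1)$ converge in $\mathcal{F}\times I$, followed by one last vertical segment $\gamma_\infty$ (possibly degenerate) starting at the limit point. The path $p$ runs through the $\pi\circ\gamma_j$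 in this order, and $\Gamma$ is the union of all the segments. The path goes only upward (resp. only downward) if all its nondegenerate segments are traversed with increasing (resp. decreasing) height; it is monotone if one of these holds. Minimal interval. For $x=[x_1,y_1]$, $y=[x_2,y_2]$, a wormhole of level $N$ is required to connect $x$ to $y$ if $(x_1)_N\ne(x_2)_N$. A minimal height interval for $x$ and $y$ is an interval $[a,b]\subseteq[0,1]$ such that (1) $h(x),h(y)\in[a,b]$; (2) $[a,b]\cap J_N\neq\emptyset$ for every $N$ such that a wormhole of level $N$ is required to connect $x$ to $y$; (3) every interval $[a',b']\subseteq[0,1]$ satisfying (1) and (2) has $b-a\le b'-a'$. (When $h(x)$ or $h(y)$ is a wormhole level, the choice of the representatives $x_1,x_2$ does not affect this notion, by (1).) Associated path. Let $[a,b]$ be a minimal height interval for $x=[x_1,y_1]$ and $y=[x_2,y_2]$. If $h(x)\le h(y)$, a path associated to $[a,b]$ is the concatenation of: the single vertical segment going down from $x$ to $[x_1,a]$; a monotone upward path from $[x_1,a]$ to $[x_2,b]$; the single vertical segment going down from $[x_2,b]$ to $y$ (vertical pieces of zero length are omitted). If $h(x)>h(y)$, it is a path obtained by this construction from $y$ to $x$, traversed backwards. *)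

(* Defs.v *)
From HB Require Import structures.
From mathcomp Require Import all_boot all_order all_algebra generic_quotient.
From mathcomp Require Import all_classical all_reals all_analysis.
From mathcomp Require Import ring.

Set Implicit Arguments.
Unset Strict Implicit.
Unset Printing Implicit Defensive.

Import Order.TTheory GRing.Theory Num.Theory numFieldNormedType.Exports.

Local Open Scope classical_set_scope.
Local Open Scope ring_scope.
Local Open Scope quotient_scope.

(* Sequences indexed by 1, 2, 3, ... on paper (digits, the m_i, the wormhole
   levels) are indexed from 0 here: [m i] stands for m_(i+1), [digit x i] for
   (x)_(i+1), [J k] for J_(k+1). *)

Section hausdorff_measure.
Context {R : realType}.

(* The norm of [R * R] in the library is the sup norm. *)
Definition euclidean_dist (p q : R * R) : R :=
  Num.sqrt ((p.1 - q.1) ^+ 2 + (p.2 - q.2) ^+ 2).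

(* Adding 0 makes the diameter of the empty set 0 instead of -oo. *)
Definition diameter (A : set (R * R)) : \bar R :=
  ereal_sup (0%E |` [set (euclidean_dist p q)%:E | p in A & q in A]).

Definition hausdorff1_pre (delta : R) (A : set (R * R)) : \bar R :=
  ereal_inf [set (\sum_(0 <= i <oo) diameter (U i))%E | U in
    [set U : nat -> set (R * R) |
      A `<=` \bigcup_i U i /\ forall i, (diameter (U i) <= delta%:E)%E]].

Definition hausdorff1 (A : set (R * R)) : \bar R :=
  ereal_sup [set hausdorff1_pre delta A | delta in [set delta | 0 < delta]].

End hausdorff_measure.

Record laakso_data (R : realType) := LaaksoData {
  Q : R;
  s : R;
  F : set R;
  n : nat;
  m : nat -> nat;
  Q_gt1 : 1 < Q;
  Q_lt2 : Q < 2;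
  log_s_2 : ln 2 / ln s = Q - 1;
  F_sub01 : F `<=` `[0, 1];
  F_neq0 : F !=set0;
  F_compact : compact F;
  F_attractor : F = [set x / s | x in F] `|` [set x / s + (s - 1) / s | x in F];
  n_le_s : n%:R <= s;
  s_lt_n1 : s < n.+1%:R;
  m_range : forall i, m i = n \/ m i = n.+1;
  m_lower : forall i, (0 < i)%N ->
    n%:R / n.+1%:R * (\prod_(j < i) (m j)%:R^-1) <= s ^- i;
  m_upper : forall i, (0 < i)%N ->
    s ^- i <= n.+1%:R / n%:R * (\prod_(j < i) (m j)%:R^-1)
}.

Section laakso_space.
Context {R : realType} (D : laakso_data R).

Definition is_expansion (x : R) (e : nat -> bool) : Prop :=
  series (fun i => (e i)%:R * ((s D - 1) / s D ^+ i.+1)) @ \oo --> x.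

(* Junk value when [x] has no expansion, which does not occur for [x] in [F]. *)
Definition digit (x : R) : nat -> bool := xget (fun=> false) (is_expansion x).

Definition omega (k : nat) (d : nat -> nat) : R :=
  \sum_(j < k.+1) (d j)%:R * \prod_(h < j.+1) (m D h)%:R^-1.

Definition J (k : nat) : set R :=
  [set omega k d | d in [set d : nat -> nat |
    (forall j, (j < k)%N -> (d j < m D j)%N) /\ (0 < d k < m D k)%N]].

Definition pre_laakso : set (R * R) := F D `*` `[0, 1].

(* The underlying type of F x I, with the topology induced by the plane. *)
Local Notation X := (set_type pre_laakso).

Definition fibre (u : X) : R := (val u).1.
Definition height (u : X) : R := (val u).2.

Definition differ_exactly_at (k : nat) (x1 x2 : R) : Prop :=
  forall i, (digit x1 i != digit x2 i) = (i == k).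

Definition wormhole_glue (u v : X) : bool :=
  `[< u = v \/ (height u = height v /\
       exists k, J k (height u) /\ differ_exactly_at k (fibre u) (fibre v)) >].

Lemma n_gt0 : (0 < n D)%N.
Proof.
rewrite lt0n; apply/eqP => n0.
have := s_lt_n1 D; have := log_s_2 D; have := Q_gt1 D; rewrite n0.
move=> Q1 h s1; have : 0 < ln 2 / ln (s D) by rewrite h subr_gt0.
have ln2 : 0 < ln (2 : R) by rewrite ln_gt0 // ltr1n.
rewrite pmulr_rgt0 // invr_gt0 ltNge.
by rewrite ln_le0 // ltW.
Qed.

Lemma s_gt1 : 1 < s D.
Proof.
have h := log_s_2 D; have Q1 := Q_gt1 D.
have : 0 < ln 2 / ln (s D) by rewrite h subr_gt0.
have ln2 : 0 < ln (2 : R) by rewrite ln_gt0 // ltr1n.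
rewrite pmulr_rgt0 // invr_gt0 => H; rewrite ltNge; apply/negP => s1.
by move: H; rewrite ltNge ln_le0.
Qed.

Lemma m_gt0 i : (0 < m D i)%N.
Proof. by case: (m_range D i) => ->; rewrite ?n_gt0. Qed.

Lemma expansion_exists x : F D x -> exists e, is_expansion x e.
Proof.
move=> Fx.
have s1 := s_gt1; have s0 : 0 < s D by apply: lt_trans s1.
have sn0 : s D != 0 by rewrite gt_eqF.
have /choice[g gP] : forall y, exists ye : R * bool, F D y ->
    F D ye.1 /\ y = ye.1 / s D + ye.2%:R * ((s D - 1) / s D).
  move=> y; have [Fy|nFy] := pselect (F D y); last by exists (0, false).
  move: (Fy); rewrite {1}F_attractor => -[] [z Fz <-].
    by exists (z, false); split => //=; rewrite mul0r addr0.
  by exists (z, true); split => //=; rewrite mul1r.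
pose xs k := iter k (fun y => (g y).1) x.
pose e k := (g (xs k)).2.
have Fxs k : F D (xs k) by elim: k => [//|k IH]; case: (gP _ IH).
exists e; rewrite /is_expansion.
pose a i : R := (e i)%:R * ((s D - 1) / s D ^+ i.+1).
have step k : series a k = x - xs k / s D ^+ k.
  elim: k => [|k IH].
    by rewrite seriesEnat /= big_geq // /xs /= divr1 subrr.
  rewrite seriesEnat /= big_nat_recr //=.
  move: IH; rewrite seriesEnat /= => ->.
  have : xs k = xs k.+1 / s D + (e k)%:R * ((s D - 1) / s D).
    by case: (gP _ (Fxs k)).
  rewrite /a exprS -[(g (xs k)).1]/(xs k.+1).
  move: (_%:R : R) (xs k) (xs k.+1) => d y z ->.
  have := expf_neq0 k sn0; move: (s D ^+ k) => t t0.
  by field; rewrite t0 sn0.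
rewrite -/a (_ : series a = (fun k => x - xs k / s D ^+ k)); last exact/funext.
rewrite -[X in _ --> X]subr0; apply: cvgB; first exact: cvg_cst.
apply: (@squeeze_cvgr _ _ _ _ (fun=> 0) (geometric 1 (s D)^-1)).
- near=> k; have /F_sub01 /= := Fxs k; rewrite in_itv /= => /andP[x0 x1].
  rewrite divr_ge0 ?exprn_ge0 ?(ltW s0) //= exprVn ler_pM2r //.
  by rewrite invr_gt0 exprn_gt0.
- exact: cvg_cst.
- apply: cvg_geometric; rewrite ger0_norm ?invr_ge0 ?(ltW s0) //.
  by rewrite invf_lt1.
Unshelve. all: by end_near.
Qed.

Lemma digit_expansion x : F D x -> is_expansion x (digit x).
Proof. by move=> /expansion_exists; exact: (@xgetPex _ (fun=> false)). Qed.

Lemma digit_inj x y : F D x -> F D y -> digit x =1 digit y -> x = y.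
Proof.
move=> /digit_expansion Ex /digit_expansion + /funext xy; rewrite -xy => Ey.
exact: (cvg_unique _ Ex Ey).
Qed.

Let M k : nat := (\prod_(h < k) m D h)%N.

Let M_neq0 k : (M k)%:R != 0 :> R.
Proof. by rewrite pnatr_eq0 -lt0n /M prodn_gt0 // => i; exact: m_gt0. Qed.

Let MS k : M k.+1 = (M k * m D k)%N.
Proof. by rewrite /M big_ord_recr. Qed.

Let m_neq0 k : (m D k)%:R != 0 :> R.
Proof. by rewrite pnatr_eq0 -lt0n m_gt0. Qed.

Let partial_omega (d : nat -> nat) k : exists A : nat,
  \sum_(j < k) (d j)%:R * \prod_(h < j.+1) (m D h)%:R^-1 = A%:R / (M k)%:R :> R.
Proof.
elim: k => [|k [A IH]]; first by exists 0%N; rewrite big_ord0 mul0r.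
exists (A * m D k + d k)%N; rewrite big_ord_recr /= IH.
rewrite prodfV -(natr_prod R) -/(M k.+1) MS !natrD !natrM.
by field; rewrite M_neq0 m_neq0.
Qed.

Let J_disjoint_lt k l t : (k < l)%N -> J k t -> J l t -> False.
Proof.
move=> kl [d _ <-] [d' [_ /andP[d0 dm]]].
have [B BE] := partial_omega d k.+1; have [A AE] := partial_omega d' l.
rewrite /omega [in LHS]big_ord_recr /= AE BE => eq.
have [C CE] : exists C, M l = (M k.+1 * C)%N.
  by exists (\prod_(k.+1 <= h < l) m D h)%N; rewrite /M -!(big_mkord xpredT)
    -big_cat_nat.
have C0 : C%:R != 0 :> R.
  by have := M_neq0 l; rewrite CE natrM mulf_eq0 negb_or => /andP[].
have : (A * m D l + d' l)%N%:R = (B * C * m D l)%N%:R :> R.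
  move: eq; rewrite prodfV -(natr_prod R) -/(M l.+1) MS CE !natrD !natrM.
  move: (M_neq0 k.+1) (m_neq0 l) C0; move: (M k.+1)%:R (m D l)%:R C%:R.
  move=> x y z x0 y0 z0 eq.
  have -> : B%:R = B%:R / x * x :> R by field.
  by rewrite -eq; field; rewrite x0 y0 z0.
move=> /eqP; rewrite eqr_nat => /eqP /(congr1 (modn^~ (m D l))).
by rewrite modnMl modnMDl modn_small // => d'0; rewrite d'0 in d0.
Qed.

Lemma J_disjoint k l t : J k t -> J l t -> k = l.
Proof.
move=> Jk Jl; case: (ltngtP k l) => // kl.
- by have := J_disjoint_lt kl Jk Jl.
- by have := J_disjoint_lt kl Jl Jk.
Qed.

Lemma wormhole_glue_refl : reflexive wormhole_glue.
Proof. by move=> u; apply/asboolP; left. Qed.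

Lemma wormhole_glue_sym : symmetric wormhole_glue.
Proof.
suff H u v : wormhole_glue u v -> wormhole_glue v u.
  by move=> u v; apply/idP/idP; exact: H.
move=> /asboolP[->|[huv [k [Jk dk]]]]; first exact: wormhole_glue_refl.
apply/asboolP; right; rewrite -huv; split => //; exists k; split => // i.
by rewrite eq_sym dk.
Qed.

Lemma wormhole_glue_trans : transitive wormhole_glue.
Proof.
move=> v u w /asboolP[->//|[huv [k [Jk dk]]]].
move=> /asboolP[<-|[hvw [l [Jl dl]]]].
  by apply/asboolP; right; split => //; exists k.
rewrite -huv in Jl; have ? := J_disjoint Jk Jl; subst l.
have Fu (z : X) : F D (fibre z) by case: (set_mem (valP z)).
apply/asboolP; left; apply/val_inj.
rewrite [LHS]surjective_pairing [RHS]surjective_pairing; congr pair; last first.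
  by rewrite -/(height u) huv hvw.
apply: digit_inj; [exact: Fu|exact: Fu|move=> i].
have := dk i; have := dl i; rewrite /fibre.
by case: (_ == k); case: (digit _ i); case: (digit _ i); case: (digit _ i).
Qed.

Definition wormhole_glue_rel := EquivRel wormhole_glue
  wormhole_glue_refl wormhole_glue_sym wormhole_glue_trans.

Definition laakso : topologicalType :=
  quotient_topology {eq_quot wormhole_glue_rel}.

Definition laakso_pi (u : X) : laakso :=
  \pi_({eq_quot wormhole_glue_rel}) u.

Definition is_path (p : R -> laakso) (x y : laakso) : Prop :=
  [/\ {within `[0, 1], continuous p}, p 0 = x & p 1 = y].

(* The condition pi(Gamma) = p([0,1]). *)
Definition is_lift (p : R -> laakso) (G : set X) : Prop :=
  laakso_pi @` G = p @` `[0, 1].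

Definition lift_length (G : set X) : \bar R := hausdorff1 (val @` G).

Definition laakso_dist (x y : laakso) : \bar R :=
  ereal_inf [set lift_length G | G in
    [set G | exists2 p, is_path p x y & is_lift p G]].

(* Maps [0,1] -> F x I are represented by maps on [R], of which only the values
   on [0,1] matter. *)
Definition vertical_segment (g : R -> X) : Prop :=
  exists x c d : R, forall t, t \in `[0, 1] -> val (g t) = (x, c + t * (d - c)).

Definition nondegenerate_segment (g : R -> X) : Prop :=
  {in `[0, 1] &, injective g}.

Definition image01 (g : R -> X) : set X := g @` `[0, 1].

(* On the time interval [t0, t1], [p] runs once through the projection of the
   segment [g], from [g 0] to [g 1], up to a monotone reparametrization. *)
Definition traverses (p : R -> laakso) (t0 t1 : R) (g : R -> X) : Prop :=
  t0 <= t1 /\ exists phi : R -> R,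
    [/\ {within `[t0, t1], continuous phi},
        {in `[t0, t1] &, {homo phi : a b / a <= b}},
        forall t, t \in `[t0, t1] -> phi t \in `[0, 1],
        g (phi t0) = g 0 /\ g (phi t1) = g 1 &
        forall t, t \in `[t0, t1] -> p t = laakso_pi (g (phi t))].

Definition linked (g g' : R -> X) : Prop :=
  g 1 <> g' 0 /\ laakso_pi (g 1) = laakso_pi (g' 0).

(* [lifted_path P p t0 t1 G]: on the time interval [t0, t1], [p] is a finite
   concatenation of constant paths, paths of the first kind (finite lists of
   segments) and paths of the second kind (infinite sequences of segments
   followed by a last segment), all of whose segments satisfy [P]; [G] is the
   union of the segments. *)
Inductive lifted_path (P : (R -> X) -> Prop) (p : R -> laakso) :
    R -> R -> set X -> Prop :=
| lifted_const (t0 t1 : R) (z : X) :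
    t0 <= t1 ->
    (forall t, t \in `[t0, t1] -> p t = laakso_pi z) ->
    lifted_path P p t0 t1 [set z]
| lifted_finite (t0 t1 : R) (k : nat) (g : nat -> R -> X) (tau : nat -> R) :
    (0 < k)%N ->
    tau 0%N = t0 ->
    tau k = t1 ->
    (forall j, (j < k)%N ->
      [/\ vertical_segment (g j), nondegenerate_segment (g j), P (g j) &
          traverses p (tau j) (tau j.+1) (g j)]) ->
    (forall j, (j.+1 < k)%N -> linked (g j) (g j.+1)) ->
    lifted_path P p t0 t1 (\bigcup_(j in `I_k) image01 (g j))
| lifted_infinite (t0 t1 c : R) (g : nat -> R -> X) (tau : nat -> R)
    (z : X) (g_oo : R -> X) :
    tau 0%N = t0 ->
    tau @ \oo --> c ->
    (forall j,
      [/\ vertical_segment (g j), nondegenerate_segment (g j), P (g j) &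
          traverses p (tau j) (tau j.+1) (g j)]) ->
    (forall j, linked (g j) (g j.+1)) ->
    (fun j => g j 1) @ \oo --> z ->
    vertical_segment g_oo ->
    P g_oo ->
    g_oo 0 = z ->
    traverses p c t1 g_oo ->
    lifted_path P p t0 t1 ((\bigcup_j image01 (g j)) `|` image01 g_oo)
| lifted_concat (t0 c t1 : R) (G1 G2 : set X) :
    lifted_path P p t0 c G1 ->
    lifted_path P p c t1 G2 ->
    lifted_path P p t0 t1 (G1 `|` G2).

Definition upward (g : R -> X) : Prop := height (g 0) <= height (g 1).

Definition wormhole_required (N : nat) (u v : X) : Prop :=
  digit (fibre u) N <> digit (fibre v) N.

Definition admissible_interval (u v : X) (a b : R) : Prop :=
  [/\ 0 <= a /\ b <= 1,
      height u \in `[a, b],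
      height v \in `[a, b] &
      forall N, wormhole_required N u v -> `[a, b] `&` J N !=set0].

Definition minimal_height_interval (u v : X) (a b : R) : Prop :=
  admissible_interval u v a b /\
  forall a' b', admissible_interval u v a' b' -> b - a <= b' - a'.

(* A single vertical segment from [u] to [v], omitted if its length is zero. *)
Definition vertical_piece (p : R -> laakso) (t0 t1 : R) (u v : X) (G : set X) :
    Prop :=
  (u = v /\ t0 = t1 /\ G = set0) \/
  (u <> v /\ exists g, [/\ vertical_segment g, g 0 = u, g 1 = v,
                           traverses p t0 t1 g & G = image01 g]).

(* The construction in the case [height u <= height v]; [u'] and [v'] are the
   points (x1, a) and (x2, b). *)
Definition associated_from (u v : X) (a b : R) (p : R -> laakso) (G : set X) :
    Prop :=
  exists (u' v' : X) (t1 t2 : R) (G1 G2 G3 : set X),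
    [/\ val u' = (fibre u, a) /\ val v' = (fibre v, b),
        vertical_piece p 0 t1 u u' G1,
        [/\ lifted_path upward p t1 t2 G2, p t1 = laakso_pi u' &
            p t2 = laakso_pi v'],
        vertical_piece p t2 1 v' v G3 &
        G = G1 `|` G2 `|` G3].

Definition associated_path (u v : X) (a b : R) (p : R -> laakso) (G : set X) :
    Prop :=
  [/\ is_path p (laakso_pi u) (laakso_pi v),
      is_lift p G &
      (height u <= height v /\ associated_from u v a b p G) \/
      (height v < height u /\ associated_from v u a b (fun t => p (1 - t)) G)].

End laakso_space.

(* Main.v *)
(* A lifted path that only goes upward has total length equal to its height
   gain, so an associated path has length at most
   [2 (b - a) - |h(y) - h(x)|]. Conversely, let [K] be any path from [x] to [y],
   say with [h(x) <= h(y)]. Call a height unseparated at scale [k] if all points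
   of [K] at this height have the same first [k] digits. Everything that [K]
   does below an unseparated height [t <= h(x)], or above an unseparated height
   [t' >= h(y)], can be cut off without affecting the first [k] digits, so
   [[t, t']] meets all required wormhole levels of order at most [k]; the levels
   of higher order are dense at a small scale, whence [b - a <= t' - t + o(1)].
   On the other hand, almost every height between [sup t] and [h(x)], or between
   [h(y)] and [inf t'], carries two points of the lift at a distance bounded
   from below, so a cover by small sets has total diameter at least
   [2 (inf t' - sup t) - (h(y) - h(x))]. *)

Require Import Defs.
From mathcomp Require Import all_boot all_order all_algebra generic_quotient finmap.
From mathcomp Require Import all_classical all_reals all_analysis measurable_realfun.
From mathcomp Require Import ring lra zify.

Set Implicit Arguments.
Unset Strict Implicit.
Unset Printing Implicit Defensive.

Import Order.TTheory GRing.Theory Num.Theory numFieldNormedType.Exports.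

Local Open Scope classical_set_scope.
Local Open Scope ring_scope.
Local Open Scope quotient_scope.

(** * Upper bounds for Hausdorff measure from explicit covers *)

Section hausdorff.
Context {R : realType}.
Implicit Types (A B : set (R * R)) (p q : R * R).

Lemma euclidean_dist_ge1 p q : `|p.1 - q.1| <= euclidean_dist p q.
Proof.
rewrite /euclidean_dist -sqrtr_sqr ler_wsqrtr// lerDl.
exact: sqr_ge0.
Qed.

Lemma euclidean_dist_ge2 p q : `|p.2 - q.2| <= euclidean_dist p q.
Proof.
rewrite /euclidean_dist -sqrtr_sqr ler_wsqrtr// lerDr.
exact: sqr_ge0.
Qed.

Lemma diameter_ge0 A : (0 <= diameter A)%E.
Proof. by apply: ereal_sup_ubound; left. Qed.

Lemma euclidean_dist_le_diameter A p q : A p -> A q ->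
  ((euclidean_dist p q)%:E <= diameter A)%E.
Proof. by move=> Ap Aq; apply: ereal_sup_ubound; right; exists p => //; exists q. Qed.

Lemma diameter_le A (c : R) : 0 <= c ->
  (forall p q, A p -> A q -> euclidean_dist p q <= c) -> (diameter A <= c%:E)%E.
Proof.
move=> c0 H; apply: ge_ereal_sup => _ [->|[p Ap [q Aq <-]]]; rewrite lee_fin//.
exact: H.
Qed.

Lemma diameter0 : diameter (set0 : set (R * R)) = 0%E.
Proof.
by apply/eqP; rewrite eq_le diameter_ge0 andbT; apply: diameter_le.
Qed.

(* Unlike the bound [hausdorff1 A <= c], which it implies, this passes to
   countable unions without any loss of epsilons. *)
Definition coverable A (c : \bar R) := forall delta : R, 0 < delta ->
  exists U : nat -> set (R * R), [/\ A `<=` \bigcup_i U i,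
    forall i, (diameter (U i) <= delta%:E)%E &
    (\sum_(0 <= i <oo) diameter (U i) <= c)%E].

Lemma coverable_hausdorff1 A c : coverable A c -> (hausdorff1 A <= c)%E.
Proof.
move=> H; apply: ge_ereal_sup => _ [d /= d0 <-].
have [U [AU Ud Uc]] := H _ d0.
by apply: le_trans Uc; apply: ereal_inf_lbound; exists U.
Qed.

Lemma coverable_ge0 A c : coverable A c -> (0 <= c)%E.
Proof.
move=> /(_ 1 ltr01) [U [_ _]]; apply: le_trans.
by apply: nneseries_ge0 => i _ _; exact: diameter_ge0.
Qed.

Lemma coverable_le A B c d : A `<=` B -> (c <= d)%E -> coverable B c -> coverable A d.
Proof.
move=> AB cd cB delta /cB[U [BU Ud Uc]]; exists U; split => //.
  exact: subset_trans BU.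
exact: le_trans Uc cd.
Qed.

(** At a common scale the covers of the [A i] are indexed by pairs; a bijection of [nat] with
    [nat * nat] merges them, and the double series of nonnegative terms may be rearranged. *)
Lemma coverable_bigcup (A : nat -> set (R * R)) (c : nat -> \bar R) :
  (forall i, coverable (A i) (c i)) ->
  coverable (\bigcup_i A i) (\sum_(0 <= i <oo) c i)%E.
Proof.
move=> Ac delta d0.
have /choice[U UP] : forall i, exists U : nat -> set (R * R),
    [/\ A i `<=` \bigcup_i U i, forall i, (diameter (U i) <= delta%:E)%E &
    (\sum_(0 <= j <oo) diameter (U j) <= c i)%E].
  by move=> i; exact: Ac.
have /card_esym/ppcard_eqP[f] := card_nat2.
have dge0 i : (0 <= (diameter \o uncurry U) i)%E by exact: diameter_ge0.
exists (uncurry U \o f); split.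
- move=> t [i _ Ait]; have [/(_ _ Ait) [j _ Uij] _ _] := UP i.
  by exists (f^-1%FUN (i, j)) => //=; rewrite invK ?inE.
- by move=> i /=; case: (f i) => a b /=; have [_ + _] := UP a; exact.
- apply: (@le_trans _ _ (\sum_(0 <= i <oo) \sum_(0 <= j <oo) diameter (U i j))%E); last first.
    apply: lee_nneseries => i _.
      by move=> _; apply: nneseries_ge0 => j _ _; exact: diameter_ge0.
    by have [_ _] := UP i.
  rewrite nneseries_esumT; last by move=> i; exact: diameter_ge0.
  rewrite -(@reindex_esum R _ _ setT setT f (diameter \o uncurry U)); last first.
    exact: bij.
  rewrite nneseries_esumT; last first.
    by move=> i; apply: nneseries_ge0 => j _ _; exact: diameter_ge0.
  rewrite (eq_esum (b := fun i => \esum_(j in [set: nat]) diameter (U i j))); last first.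
    by move=> i _; rewrite nneseries_esumT// => j; exact: diameter_ge0.
  rewrite (@esum_esum _ _ _ setT (fun=> setT) (fun i j => diameter (U i j))); last first.
    by move=> i j _ _; exact: diameter_ge0.
  rewrite (_ : _ `*`` _ = setT); last by apply/seteqP; split.
  by apply: le_esum => -[a b].
Qed.

Lemma coverable0 : coverable set0 0%E.
Proof.
move=> d d0; exists (fun=> set0); split => //.
  by move=> i; rewrite diameter0 lee_fin ltW.
by rewrite eseries0// => i _ _; rewrite diameter0.
Qed.

Lemma coverableU A B (c d : R) : coverable A c%:E -> coverable B d%:E ->
  coverable (A `|` B) (c + d)%:E.
Proof.
move=> Ac Bd.
pose E i := if i is 0 then A else if i is 1 then B else set0.
pose e i := if i is 0 then c%:E else if i is 1 then d%:E else 0%E : \bar R.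
apply: (@coverable_le _ (\bigcup_i E i) (\sum_(0 <= i <oo) e i)%E); last first.
- by apply: coverable_bigcup => -[|[|i]] //; exact: coverable0.
- have e0 i : (0 <= e i)%E.
    by case: i => [|[|i]] //=; [exact: coverable_ge0 Ac|exact: coverable_ge0 Bd].
  rewrite (nneseries_split 0 2)//.
  rewrite eseries0 ?adde0; last by move=> [|[|i]].
  by rewrite add0n !big_nat_recr//= big_geq// add0e EFinD.
- by move=> x [Ax|Bx]; [exists 0%N|exists 1%N].
Qed.

(** Cutting into [N] equal pieces with [N] above [(d - c) / delta] makes each piece small, while the
    diameters still add up to [d - c]. *)
Lemma coverable_vertical (x c d : R) : c <= d ->
  coverable [set (x, t) | t in `[c, d]] (d - c)%:E.
Proof.
move=> cd delta d0.
pose M := Num.bound ((d - c) / delta); pose N := M.+1.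
pose l := (d - c) / N%:R.
have N0 : 0 < N%:R :> R by rewrite ltr0n.
have l0 : 0 <= l by rewrite divr_ge0 ?subr_ge0.
have ld : l <= delta.
  rewrite /l ler_pdivrMr// mulrC -ler_pdivrMr//.
  have := archi_boundP (divr_ge0 (_ : 0 <= d - c) (ltW d0)).
  rewrite subr_ge0 => /(_ cd) /ltW /le_trans; apply.
  by rewrite ler_nat.
pose U i := if (i < N)%N then [set (x, t) | t in `[c + i%:R * l, c + i.+1%:R * l]] else set0.
have dU i : (i < N)%N -> (diameter (U i) <= l%:E)%E.
  move=> iN; rewrite /U iN; apply: diameter_le => // _ _ [t tI <-] [t' t'I <-].
  rewrite /euclidean_dist /= subrr expr0n add0r sqrtr_sqr.
  move: tI t'I => /=; rewrite !in_itv/= -natr1 mulrDl mul1r ler_norml => /andP[t1 t2] /andP[t3 t4].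
  by apply/andP; split; lra.
exists U; split.
- move=> _ [t + <-]; rewrite /= in_itv/= => /andP[ct td].
  have [cd'|ncd] := eqVneq c d.
    exists 0%N => //; rewrite /U/=; exists t => //.
    have -> : t = c by apply/eqP; rewrite eq_le ct andbT cd'.
    by rewrite /= in_itv/= mul0r addr0 lexx/= lerDl mul1r.
  have lt0 : 0 < l by rewrite divr_gt0// subr_gt0 lt_neqAle ncd.
  (* Truncation would give the right end point the index [N], so it is put in the last piece [M]. *)
  have [tN|tN] := eqVneq t d.
    exists M => //; rewrite /U/= ltnSn; exists t => //=; rewrite in_itv/= tN /l.
    rewrite -/N [N%:R * _]mulrC -mulrA mulVf ?gt_eqF// mulr1.
    have -> : c + (d - c) = d by ring.
    rewrite lexx andbT -lerBrDl mulrCA.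
    by rewrite ler_piMr ?subr_ge0// ler_pdivrMr// mul1r ler_nat.
  pose i := Num.trunc ((t - c) / l).
  have q0 : 0 <= (t - c) / l by rewrite divr_ge0 ?subr_ge0.
  have /andP[] := truncn_itv q0; rewrite -/i.
  rewrite ler_pdivlMr// ltr_pdivrMr// => i1 i2.
  have iN : (i < N)%N.
    rewrite -(ltr_nat R) -(ltr_pM2r lt0); apply: le_lt_trans i1 _.
    rewrite /l mulrCA mulfV ?gt_eqF// mulr1 ltrD2r lt_neqAle tN //.
  exists i => //; rewrite /U iN; exists t => //=; rewrite in_itv/=.
  by apply/andP; split; lra.
- move=> i; have [iN|iN] := ltnP i N; last first.
    by rewrite /U ltnNge iN diameter0 lee_fin ltW.
  by apply: le_trans (dU _ iN) _; rewrite lee_fin.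
- rewrite (nneseries_split 0 N)//; last by move=> i _; exact: diameter_ge0.
  rewrite eseries0 ?adde0; last first.
    by move=> i; rewrite /U add0n => /[1!leqNgt] /negbTE -> _; rewrite diameter0.
  rewrite add0n; apply: (@le_trans _ _ (\sum_(0 <= i < N) l%:E)%E).
    rewrite big_nat [leRHS]big_nat; apply: lee_sum => i /andP[_ iN].
    exact: dU.
  rewrite sumEFin lee_fin sumr_const_nat subn0 -mulr_natr /l divfK ?gt_eqF//.
Qed.

End hausdorff.

(** * Heights on the quotient and the length of upward paths *)

Section laakso_heights.
Context {R : realType} (D : laakso_data R).
Local Notation X := (set_type (pre_laakso D)).
Implicit Types (u v w : X) (z : laakso D).

Lemma laakso_piP u v : laakso_pi u = laakso_pi v <-> wormhole_glue u v.
Proof.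
by split => /(@eqmodP _ (wormhole_glue_rel D)).
Qed.

Lemma laakso_pi_repr z : laakso_pi (repr z) = z.
Proof. exact: reprK. Qed.

Lemma height_glue u v : wormhole_glue u v -> height u = height v.
Proof. by move=> /asboolP[->|[]]. Qed.

(** Any representative gives the same value, since glued points have equal height. *)
Definition laakso_height z : R := height (repr z).

Lemma laakso_height_pi u : laakso_height (laakso_pi u) = height u.
Proof. by apply: height_glue; apply/laakso_piP; exact: laakso_pi_repr. Qed.

Lemma val_continuous : continuous (val : X -> R * R).
Proof. exact: initial_continuous. Qed.

Lemma height_continuous : continuous (@height R D).
Proof. by move=> u; apply: continuous_comp; [exact: val_continuous|exact: cvg_snd]. Qed.

Lemma fibre_continuous : continuous (@fibre R D).
Proof. by move=> u; apply: continuous_comp; [exact: val_continuous|exact: cvg_fst]. Qed.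

Lemma fibre_F u : F D (fibre u).
Proof. by case: (set_mem (valP u)). Qed.

Lemma height_itv u : 0 <= height u <= 1.
Proof. by case: (set_mem (valP u)) => _ /=; rewrite in_itv. Qed.

Lemma image01_coverable (g : R -> X) : vertical_segment g ->
  coverable (val @` image01 g) `|height (g 1) - height (g 0)|%:E.
Proof.
move=> [x [c [d gE]]].
have g0 : height (g 0) = c by rewrite /height gE ?in_itv/= ?lexx ?ler01// mul0r addr0.
have g1 : height (g 1) = d by rewrite /height gE ?in_itv/= ?lexx ?ler01// mul1r addrC subrK.
rewrite g0 g1.
have [cd|/ltW dc] := leP c d.
- rewrite ger0_norm ?subr_ge0//.
  apply: coverable_le (lexx _) (coverable_vertical x cd).
  move=> _ [_ [t /= tI <-] <-]; exists (c + t * (d - c)); last by rewrite gE.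
  move: tI; rewrite /= !in_itv/= => /andP[t0 t1].
  by apply/andP; split; nra.
- rewrite ler0_norm ?subr_le0// opprB.
  apply: coverable_le (lexx _) (coverable_vertical x dc).
  move=> _ [_ [t /= tI <-] <-]; exists (c + t * (d - c)); last by rewrite gE.
  move: tI; rewrite /= !in_itv/= => /andP[t0 t1].
  by apply/andP; split; nra.
Qed.

Lemma traverses_start p t0 t1 (g : R -> X) : traverses p t0 t1 g ->
  p t0 = laakso_pi (g 0).
Proof.
move=> [t01 [phi [_ _ _ [g0 _] pE]]].
by rewrite pE ?g0// in_itv/= lexx.
Qed.

Lemma traverses_end p t0 t1 (g : R -> X) : traverses p t0 t1 g ->
  p t1 = laakso_pi (g 1).
Proof.
move=> [t01 [phi [_ _ _ [_ g1] pE]]].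
by rewrite pE ?g1// in_itv/= lexx andbT.
Qed.

Lemma upward_coverable (g : R -> X) : vertical_segment g -> upward g ->
  coverable (val @` image01 g) (height (g 1) - height (g 0))%:E.
Proof.
by move=> /image01_coverable + ug; rewrite ger0_norm// subr_ge0.
Qed.

(** The segments [j] and [j.+1] meet at the same point [p (tau j.+1)] of the quotient, where the
    height is well defined, so the lengths, being height gains, telescope. *)
Lemma lifted_upward_coverable p t0 t1 (G : set X) : lifted_path (@upward R D) p t0 t1 G ->
  coverable (val @` G) (laakso_height (p t1) - laakso_height (p t0))%:E.
Proof.
elim=> {t0 t1 G} [t0 t1 z t01 pz|t0 t1 k g tau k0 <- <- gP _
  |t0 t1 c g tau z goo tau0 tauc gP _ gz vgoo ugoo goo0 tgoo
  |t0 c t1 G1 G2 _ IH1 _ IH2].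
- rewrite !pz ?in_itv/= ?lexx ?t01// subrr.
  apply: coverable_le (coverable_vertical (fibre z) (lexx (height z))).
    move=> _ [_ -> <-]; exists (height z); first by rewrite /= in_itv/= lexx.
    by rewrite -surjective_pairing.
  by rewrite subrr.
- pose f j := laakso_height (p (tau j)).
  have fE j : (j < k)%N -> f j.+1 - f j = height (g j 1) - height (g j 0).
    move=> /gP[_ _ _ t]; rewrite /f (traverses_start t) (traverses_end t).
    by rewrite !laakso_height_pi.
  have := @coverable_bigcup R (fun j => if (j < k)%N then val @` image01 (g j) else set0)
    (fun j => if (j < k)%N then (f j.+1 - f j)%:E else 0%E).
  move=> H; apply: coverable_le (H _).
  + move=> _ [_ [j /= jk [t tI <-]] <-]; exists j => //; rewrite jk.
    by exists (g j t) => //; exists t.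
  + rewrite (nneseries_split 0 k)//; last first.
      move=> j _; case: ifPn => // jk; rewrite lee_fin fE// subr_ge0.
      by case: (gP j jk).
    rewrite eseries0 ?adde0; last first.
      by move=> j; rewrite add0n leqNgt => /negbTE ->.
    rewrite add0n (eq_big_nat _ _ (F2 := fun j => (f j.+1 - f j)%:E)); last first.
      by move=> j /andP[_ ->].
    by rewrite sumEFin telescope_sumr.
  + move=> j; have [jk|_] := boolP (j < k)%N; last exact: coverable0.
    by rewrite fE//; case: (gP j jk) => vg _ ug _; exact: upward_coverable.
- pose f j := laakso_height (p (tau j)).
  have fE j : f j.+1 - f j = height (g j 1) - height (g j 0).
    have [_ _ _ t] := gP j; rewrite /f (traverses_start t) (traverses_end t).
    by rewrite !laakso_height_pi.
  have fS j : f j.+1 = height (g j 1).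
    by have [_ _ _ t] := gP j; rewrite /f (traverses_end t) laakso_height_pi.
  (* The partial sums of the gains converge because the ends [g j 1] tend to [z], where [goo]
     starts. *)
  have f_cvg : f n @[n --> \oo] --> height z.
    rewrite -cvg_shiftS /=.
    under eq_fun do rewrite fS.
    exact: (continuous_cvg _ (@height_continuous z) gz).
  rewrite image_setU.
  have -> : laakso_height (p t1) - laakso_height (p t0) =
     (height z - f 0%N) + (height (goo 1) - height (goo 0)).
    rewrite (traverses_end tgoo) laakso_height_pi goo0 /f tau0.
    by ring.
  apply: coverableU; last exact: upward_coverable.
  rewrite image_bigcup.
  apply: coverable_le (coverable_bigcup (A := fun j => val @` image01 (g j))
    (c := fun j => (f j.+1 - f j)%:E) _) => //.
  + suff -> : (\sum_(0 <= j <oo) (f j.+1 - f j)%:E = (height z - f 0%N)%:E)%E by [].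
    apply/cvg_lim => //.
    under eq_fun do rewrite sumEFin telescope_sumr//.
    by apply: cvg_EFin; [exact: nearW|apply: cvgB => //; exact: cvg_cst].
  + by move=> j; rewrite fE; have [vg _ ug _] := gP j; exact: upward_coverable.
- rewrite image_setU.
  have -> : laakso_height (p t1) - laakso_height (p t0) =
   (laakso_height (p c) - laakso_height (p t0)) + (laakso_height (p t1) - laakso_height (p c)).
    by ring.
  exact: coverableU.
Qed.

Lemma vertical_piece_coverable p t0 t1 u v (G : set X) :
  vertical_piece p t0 t1 u v G ->
  coverable (val @` G) `|height v - height u|%:E.
Proof.
case=> [[<- [_ ->]]|[_ [g [vg <- <- _ ->]]]].
  by rewrite image_set0 subrr normr0; exact: coverable0.
exact: image01_coverable.
Qed.

(** The vertical pieces contribute [height u - a] and [b - height v], the upward part [b - a]. *)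
Lemma associated_from_length u v (a b : R) p (G : set X) :
  a <= height u -> height v <= b -> associated_from u v a b p G ->
  (lift_length G <= (2 * (b - a) - (height v - height u))%:E)%E.
Proof.
move=> au vb [u' [v' [t1 [t2 [G1 [G2 [G3 [[u'E v'E] p1 [p2 pt1 pt2] p3 ->]]]]]]]].
have hu' : height u' = a by rewrite /height u'E.
have hv' : height v' = b by rewrite /height v'E.
apply: coverable_hausdorff1; rewrite !image_setU.
have -> : 2 * (b - a) - (height v - height u) =
  `|height u' - height u| + (laakso_height (p t2) - laakso_height (p t1)) + `|height v - height v'|.
  rewrite pt1 pt2 !laakso_height_pi hu' hv' !ler0_norm ?subr_le0//; ring.
apply: coverableU; last exact: vertical_piece_coverable p3.
apply: coverableU; first exact: vertical_piece_coverable p1.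
exact: lifted_upward_coverable.
Qed.

End laakso_heights.

(** * Digits in the Cantor set and their local constancy *)

Section digits.
Context {R : realType} (D : laakso_data R).
Local Notation s := (s D).
Implicit Types (x y : R) (e : nat -> bool).

(** This follows from [ln 2 / ln s = Q - 1 < 1], and keeps the two halves of the Cantor set at a
    positive distance. *)
Lemma s_gt2 : 2 < s.
Proof.
have s1 := s_gt1 D; have s0 : 0 < s by exact: lt_trans s1.
have := Q_lt2 D; rewrite -(ltrD2r (-1)) -(log_s_2 D).
have lns : 0 < ln s by rewrite ln_gt0.
rewrite ltr_pdivrMr// (_ : 2 - 1 = 1 :> R); last by ring.
by rewrite mul1r ltr_ln ?posrE.
Qed.

Let s0 : 0 < s. Proof. by apply: lt_trans s_gt2. Qed.
Let sn0 : s != 0. Proof. by rewrite gt_eqF. Qed.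
Let sXn0 k : s ^+ k != 0. Proof. by rewrite expf_neq0. Qed.

(** The partial sums are at most those with all digits equal to 1, which telescope to
    [1 - s ^- k]. *)
Lemma expansion_itv x e : is_expansion D x e -> 0 <= x <= 1.
Proof.
move=> ex.
have bd k : 0 <= series (fun i => (e i)%:R * ((s - 1) / s ^+ i.+1)) k <= 1 - s ^- k.
  elim: k => [|k /andP[IH0 IH1]].
    by rewrite seriesEnat /= big_geq// expr0 invr1 subrr lexx.
  have t0 : 0 <= (s - 1) / s ^+ k.+1.
    by rewrite divr_ge0 ?exprn_ge0 ?ltW// subr_gt0 s_gt1.
  rewrite seriesSr/=; apply/andP; split.
    by rewrite addr_ge0// mulr_ge0.
  have -> : 1 - s ^- k.+1 = 1 - s ^- k + (s - 1) / s ^+ k.+1.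
    rewrite exprS; have := sXn0 k.
    by move: (s ^+ k) => t ?; field; apply/andP.
  by rewrite lerD// ler_piMl//; case: (e k); rewrite ?ler01.
apply/andP; split.
- by apply: cvgr_to_ge ex _; apply: nearW => k; case/andP: (bd k).
- apply: cvgr_to_le ex _; apply: nearW => k; case/andP: (bd k) => _.
  by move/le_trans; apply; rewrite lerBlDr lerDl invr_ge0 exprn_ge0// ltW.
Qed.

Lemma expansion_shift x e : is_expansion D x e ->
  is_expansion D (s * x - (e 0%N)%:R * (s - 1)) (fun i => e i.+1).
Proof.
rewrite /is_expansion -cvg_shiftS /= => ex.
have : s * series (fun i => (e i)%:R * ((s - 1) / s ^+ i.+1)) n.+1 - (e 0%N)%:R * (s - 1)
    @[n --> \oo] --> s * x - (e 0%N)%:R * (s - 1).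
  by apply: cvgB; [exact: cvgMl_tmp|exact: cvg_cst].
apply: cvg_trans; apply: near_eq_cvg; apply: nearW => k.
rewrite !seriesEnat /= big_nat_recl//= mulrDr addrAC expr1.
have -> : s * ((e 0%N)%:R * ((s - 1) / s)) = (e 0%N)%:R * (s - 1) by field.
rewrite subrr add0r mulr_sumr; apply: eq_bigr => i _.
rewrite [s ^+ i.+2]exprS; have := sXn0 i.+1.
by move: (s ^+ i.+1) (_%:R : R) => t d ?; field; apply/andP.
Qed.

(* Expansions that first disagree at index [i] are at least
   [(s - 1) / s ^ i.+1 - 1 / s ^ i.+1] apart. *)
Lemma expansion_gap k x y e e' :
  is_expansion D x e -> is_expansion D y e' -> `|x - y| < (s - 2) / s ^+ k ->
  forall i, (i < k)%N -> e i = e' i.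
Proof.
elim: k x y e e' => [//|k IH] x y e e' ex ey.
rewrite exprS invfM mulrA mulrAC ltr_pdivlMr//.
rewrite mulrC -[X in X * _]gtr0_norm// -normrM mulrBr => xy.
have sk : s ^- k <= 1 by rewrite invf_le1 ?exprn_gt0// exprn_ege1// ltW// s_gt1.
have xy1 : `|s * x - s * y| < s - 2.
  by apply: lt_le_trans xy _; rewrite ler_piMr// subr_ge0 ltW// s_gt2.
have /andP[x0 x1] := expansion_itv (expansion_shift ex).
have /andP[y0 y1] := expansion_itv (expansion_shift ey).
have s2 := s_gt2.
(* Both shifted values lie in [[0, 1]], so different first digits would put [s * x] and [s * y] at
   least [(s - 1) - 1] apart. *)
have e0 : e 0%N = e' 0%N.
  move: x0 x1 y0 y1 xy1; rewrite ltr_norml => + + + + /andP[].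
  by case: (e 0%N); case: (e' 0%N) => //=; rewrite ?mul1r ?mul0r; lra.
case=> [//|i]; rewrite ltnS => ik.
apply: (IH _ _ (fun i => e i.+1) (fun i => e' i.+1) (expansion_shift ex) (expansion_shift ey)) ik.
rewrite e0 (_ : _ - _ = s * x - s * y); last by ring.
exact: xy.
Qed.

Lemma digit_gap k x y : F D x -> F D y -> `|x - y| < (s - 2) / s ^+ k ->
  forall i, (i < k)%N -> digit D x i = digit D y i.
Proof.
by move=> Fx Fy; apply: expansion_gap; exact: digit_expansion.
Qed.

Lemma digit_gap_gt0 k : 0 < (s - 2) / s ^+ k.
Proof. by rewrite divr_gt0 ?exprn_gt0// subr_gt0 s_gt2. Qed.

Local Notation X := (set_type (pre_laakso D)).

Lemma open_digit N b : open [set w : X | digit D (fibre w) N = b].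
Proof.
rewrite openE => w /= wb; rewrite /interior /=.
have := @fibre_continuous _ D w.
move=> /cvgrPdist_lt /(_ _ (digit_gap_gt0 N.+1)); apply: filterS => w' ww'.
by rewrite /= -wb; apply/esym; apply: digit_gap ww' _ _ => //; exact: fibre_F.
Qed.

Lemma closed_digit N b : closed [set w : X | digit D (fibre w) N = b].
Proof.
have := open_closedC (open_digit N (~~ b)); congr closed.
apply/seteqP; split => w /=; case: (digit _ _ _) => //; case: b => //.
all: by move=> H; exfalso; apply: H.
Qed.

End digits.

(** * Wormhole levels as fractions, their finiteness and density *)

Section wormhole_levels.
Context {R : realType} (D : laakso_data R).

Lemma n_gt1 : (1 < n D)%N.
Proof.
have := lt_trans (s_gt2 D) (s_lt_n1 D).
by rewrite (ltr_nat R 2) ltnS.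
Qed.

Lemma m_gt1 i : (1 < m D i)%N.
Proof. by case: (m_range D i) => ->; [|apply: ltnW]; exact: n_gt1. Qed.

Definition mprod k : nat := (\prod_(h < k) m D h)%N.

Lemma mprodS k : mprod k.+1 = (mprod k * m D k)%N.
Proof. by rewrite /mprod big_ord_recr. Qed.

Lemma mprod_gt0 k : (0 < mprod k)%N.
Proof. by rewrite /mprod prodn_gt0// => i; exact: m_gt0. Qed.

Lemma mprod_gtn k : (k < mprod k)%N.
Proof.
elim: k => [|k IH]; first exact: mprod_gt0.
rewrite mprodS; have := m_gt1 k; have := IH; nia.
Qed.

Lemma mprod_neq0 k : (mprod k)%:R != 0 :> R.
Proof. by rewrite pnatr_eq0 -lt0n mprod_gt0. Qed.

Lemma prod_mV k : \prod_(h < k) (m D h)%:R^-1 = (mprod k)%:R^-1 :> R.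
Proof. by rewrite prodfV -natr_prod. Qed.

Lemma partial_omega_step (d : nat -> nat) k A :
  \sum_(j < k) (d j)%:R * \prod_(h < j.+1) (m D h)%:R^-1 = A%:R / (mprod k)%:R :> R ->
  \sum_(j < k.+1) (d j)%:R * \prod_(h < j.+1) (m D h)%:R^-1 =
    (A * m D k + d k)%N%:R / (mprod k.+1)%:R :> R.
Proof.
move=> IH; rewrite big_ord_recr /= IH prod_mV mprodS natrD !natrM.
have : (m D k)%:R != 0 :> R by rewrite pnatr_eq0 -lt0n m_gt0.
have := mprod_neq0 k.
by move: (_%:R) (_%:R) (_%:R) (_%:R) => *; field; apply/andP.
Qed.

Lemma partial_omega_ratio (d : nat -> nat) k : (forall j, (j < k)%N -> (d j < m D j)%N) ->
  exists2 A : nat, (A < mprod k)%N &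
    \sum_(j < k) (d j)%:R * \prod_(h < j.+1) (m D h)%:R^-1 = A%:R / (mprod k)%:R :> R.
Proof.
elim: k => [|k IH] dm.
  by exists 0%N; [exact: mprod_gt0|rewrite big_ord0 mul0r].
have [j jk|A Ak AE] := IH; first by apply: dm; exact: ltnW.
exists (A * m D k + d k)%N; last exact: partial_omega_step.
by rewrite mprodS; have := dm k (ltnSn k); nia.
Qed.

(** Mixed radix expansion of [A]: the last digit is a remainder, the others come from the quotient.
    The last digit is recorded because it decides membership in [J]. *)
Lemma ratio_partial_omega k A : (A < mprod k)%N ->
  exists d : nat -> nat, [/\ forall j, (j < k)%N -> (d j < m D j)%N,
    forall j, j.+1 = k -> d j = (A %% m D j)%N &
    \sum_(j < k) (d j)%:R * \prod_(h < j.+1) (m D h)%:R^-1 = A%:R / (mprod k)%:R :> R].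
Proof.
elim: k A => [|k IH] A.
  rewrite /mprod big_ord0 ltnS leqn0 => /eqP ->.
  by exists (fun=> 0%N); split => //; rewrite big_ord0 mul0r.
rewrite mprodS -ltn_divLR ?m_gt0// => /IH[d [dm _ dE]].
pose d' j := (if j == k then A %% m D k else d j)%N.
exists d'; split.
- move=> j; rewrite /d' ltnS leq_eqVlt; case: eqP => [->|_] /=; last exact: dm.
  by rewrite ltn_mod m_gt0.
- by move=> j [->]; rewrite /d' eqxx.
- have /partial_omega_step -> : \sum_(j < k) (d' j)%:R * \prod_(h < j.+1) (m D h)%:R^-1 =
      (A %/ m D k)%N%:R / (mprod k)%:R :> R.
    by rewrite -dE; apply: eq_bigr => j _; rewrite /d' ltn_eqF.
  by rewrite /d' eqxx -divn_eq mprodS.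
Qed.

Lemma J_ratio k t : J D k t -> exists2 A : nat, (A < mprod k.+1)%N & t = A%:R / (mprod k.+1)%:R.
Proof.
move=> [d [dm /andP[_ dk]] <-]; have [j|A Ak AE] := @partial_omega_ratio d k.+1.
  by rewrite ltnS leq_eqVlt => /orP[/eqP ->//|]; exact: dm.
by exists A.
Qed.

(** Nondivisibility by [m D k] says that the last mixed radix digit is nonzero. *)
Lemma ratio_J k A : (A < mprod k.+1)%N -> ~~ (m D k %| A)%N ->
  J D k (A%:R / (mprod k.+1)%:R).
Proof.
move=> /ratio_partial_omega[d [dm dk dE]] mA; exists d; last exact: dE.
split; first by move=> j jk; apply: dm; exact: ltnW.
rewrite dm//= dk// lt0n.
by rewrite andbT.
Qed.

Lemma finite_J k : finite_set (J D k).
Proof.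
apply: (@sub_finite_set _ _ ((fun A : nat => A%:R / (mprod k.+1)%:R) @` `I_(mprod k.+1))).
  by move=> t /J_ratio[A Ak ->]; exists A.
exact: finite_image.
Qed.

(** Fractions of denominator [mprod N.+1] have a step of at most [e / 2], and of two consecutive
    numerators one is not divisible by [m D N], which exceeds 1. *)
Lemma J_dense (e : R) : 0 < e -> exists k, forall N (c : R), (k <= N)%N -> 0 <= c -> c + e <= 1 ->
  `[c, c + e] `&` J D N !=set0.
Proof.
move=> e0; exists (Num.bound (2 / e)) => N c kN c0 ce1.
set M := mprod N.+1.
have M0 : 0 < M%:R :> R by rewrite ltr0n mprod_gt0.
have Me : 2 <= e * M%:R.
  rewrite mulrC -ler_pdivrMr//.
  have /archi_boundP/ltW/le_trans : 0 <= 2 / e by rewrite divr_ge0// ltW.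
  by apply; rewrite ler_nat (leq_trans kN)// ltnW// ltnW// mprod_gtn.
have cM : 0 <= c * M%:R by rewrite mulr_ge0// ltW.
(* [A] is the least integer strictly above [c * M], so [A.+1] is still at most
   [c * M + 2 <= (c + e) * M]. *)
pose A := (Num.trunc (c * M%:R)).+1.
have /andP[A1 A2] := truncn_itv cM.
have [B AB mB] : exists2 B, (A <= B <= A.+1)%N & ~~ (m D N %| B)%N.
  have [mA|mA] := boolP (m D N %| A)%N; last by exists A; rewrite ?leqnn ?leqnSn.
  exists A.+1; rewrite ?leqnn ?leqnSn//.
  by rewrite -addn1 dvdn_addr// dvdn1 gtn_eqF// m_gt1.
move: AB => /andP[AB BA].
have cB : c * M%:R <= B%:R by rewrite (le_trans (ltW A2))// ler_nat.
have Bc : B%:R <= (c + e) * M%:R.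
  apply: (@le_trans _ _ A.+1%:R); first by rewrite ler_nat.
  rewrite mulrDl -!natr1; apply: le_trans (lerD A1 Me).
  by rewrite -addrA.
(* The numerator [M] itself, that is the height 1, is excluded because [m D N] divides [M]. *)
have BM : (B < M)%N.
  rewrite ltn_neqAle; apply/andP; split.
    by apply: contra mB => /eqP ->; rewrite /M mprodS dvdn_mull.
  by rewrite -(ler_nat R) (le_trans Bc)// ler_piMl// ltW.
exists (B%:R / M%:R); split; last exact: ratio_J.
by rewrite /= in_itv/= ler_pdivlMr// ler_pdivrMr// cB.
Qed.

Lemma countable_J : countable (\bigcup_k J D k).
Proof. by apply: bigcup_countable => // k _; apply: finite_set_countable; exact: finite_J. Qed.

End wormhole_levels.

(** * Cutting off excursions at unseparated heights *)

Section cutting.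
Context {R : realType} (D : laakso_data R).
Local Notation X := (set_type (pre_laakso D)).
Implicit Types (u v w : X) (K : set (laakso D)) (t : R).

Lemma digit_glue u v N : wormhole_glue u v -> ~ J D N (height u) ->
  digit D (fibre u) N = digit D (fibre v) N.
Proof.
move=> /asboolP[->//|[_ [k [Jk dk]]]] nJ; apply/eqP.
by rewrite -[_ == _]negbK dk; apply/eqP => Nk; apply: nJ; rewrite Nk.
Qed.

(** A closed union of gluing classes descends to a closed set of the quotient; invariance makes the
    choice made by [repr] immaterial. *)
Lemma closed_laakso (P : set X) :
  (forall w w', wormhole_glue w w' -> P w -> P w') -> closed P ->
  closed [set z : laakso D | P (repr z)].
Proof.
move=> Pinv cP; rewrite -[X in closed X]setCK; apply: open_closedC.
suff : open ((@laakso_pi R D) @^-1` ~` [set z | P (repr z)]) by [].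
rewrite (_ : _ @^-1` _ = ~` P); first exact: closed_openC.
have piw w : wormhole_glue w (repr (laakso_pi w)).
  by apply/laakso_piP; rewrite laakso_pi_repr.
apply/seteqP; split => w /= nP Pw; apply: nP.
- exact: Pinv Pw.
- by apply: Pinv Pw; rewrite wormhole_glue_sym.
Qed.

Definition unseparated K k t := forall w w', height w = t -> height w' = t ->
  K (laakso_pi w) -> K (laakso_pi w') ->
  forall N, (N < k)%N -> digit D (fibre w) N = digit D (fibre w') N.

(* Below [t] the [N]-th digit may change, but a connected set returns to the
   height [t] with the digit that it had when it left it; so the digit, frozen
   outside of [[t, t']], is locally constant on [K]. *)
Lemma unseparated_meets_J K u v t t' k N : connected K ->
  K (laakso_pi u) -> K (laakso_pi v) ->
  t <= height u <= t' -> t <= height v <= t' ->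
  unseparated K k t -> unseparated K k t' -> (N < k)%N ->
  wormhole_required N u v -> `[t, t'] `&` J D N !=set0.
Proof.
move=> cK Ku Kv hu hv ut ut' Nk uv; apply: contrapT => /set0P/negP/negPn/eqP tJ.
have nJ w : t <= height w <= t' -> ~ J D N (height w).
  move=> hw Jw; suff : (`[t, t'] `&` J D N) (height w) by rewrite tJ.
  by split => //; rewrite /= in_itv.
(* When [K] does not reach the height [t0], any value serves as [d]. *)
have digit_at t0 : unseparated K k t0 -> exists d, forall w, height w = t0 ->
    K (laakso_pi w) -> digit D (fibre w) N = d.
  move=> ut0; have [[w0 [h0 K0]]|no] := pselect (exists w, height w = t0 /\ K (laakso_pi w)).
    by exists (digit D (fibre w0) N) => w hw Kw; exact: ut0.
  by exists false => w hw Kw; exfalso; apply: no; exists w.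
have [d dP] := digit_at _ ut; have [d' d'P] := digit_at _ ut'.
pose P b := [set w : X | t <= height w <= t' /\ digit D (fibre w) N = b] `|`
  [set w | height w <= t /\ d = b] `|` [set w | t' <= height w /\ d' = b].
have tt' : t <= t' by case/andP: hu; exact: le_trans.
(* Gluing at a height in [[t, t']] leaves the digit [N] alone, since [J D N] misses that
   interval. *)
have Pinv b w w' : wormhole_glue w w' -> P b w -> P b w'.
  move=> ww'; rewrite /P /= (height_glue ww') => -[[[hw wb]|?]|?]; [|by left; right|by right].
  left; left; split => //; rewrite -wb; apply/esym/(digit_glue ww').
  by rewrite (height_glue ww'); exact: nJ.
have cle r : closed [set w : X | height w <= r].
  exact: (closed_comp (fun w _ => @height_continuous _ D w) (@closed_le _ r)).
have cge r : closed [set w : X | r <= height w].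
  exact: (closed_comp (fun w _ => @height_continuous _ D w) (@closed_ge _ r)).
have cand (A : set X) (Q : Prop) : closed A -> closed [set w | A w /\ Q].
  move=> cA; have [q|nq] := pselect Q.
    by rewrite (_ : [set _ | _] = A)//; apply/seteqP; split => w //= [].
  by rewrite (_ : [set _ | _] = set0)//; [exact: closed0|apply/seteqP; split => w //= []].
have cP b : closed (P b).
  apply: closedU; last exact: cand (cge t').
  apply: closedU; last exact: cand (cle t).
  rewrite (_ : [set _ | _] = [set w | t <= height w] `&` [set w | height w <= t'] `&`
    [set w | digit D (fibre w) N = b]).
    by apply: closedI; [exact: closedI|exact: closed_digit].
  by apply/seteqP; split => w /= [] => [/andP[]|[-> ->]].
pose C b := [set z : laakso D | P b (repr z)].
have cC b : closed (C b) by exact: closed_laakso (Pinv b) (cP b).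
have CP b w : C b (laakso_pi w) <-> P b w.
  have ww : wormhole_glue w (repr (laakso_pi w)).
    by apply/laakso_piP; rewrite laakso_pi_repr.
  by split; apply: Pinv; rewrite // wormhole_glue_sym.
have Pdigit b w : K (laakso_pi w) -> t <= height w <= t' -> P b w ->
    digit D (fibre w) N = b.
  move=> Kw /andP[h1 h2] [[[_ //]|[h3 <-]]|[h3 <-]].
  - by apply: dP => //; apply/eqP; rewrite eq_le h1 h3.
  - by apply: d'P => //; apply/eqP; rewrite eq_le h2 h3.
(* By [Pex] and [Ptot], [C b] and [C (~~ b)] split [K] into disjoint closed parts, so each is also
   relatively open. *)
have Pex b w : K (laakso_pi w) -> P b w -> ~ P (~~ b) w.
  move=> Kw Pb Pnb.
  have [hw|] := boolP (t <= height w <= t').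
    have := Pdigit _ _ Kw hw Pb; rewrite (Pdigit _ _ Kw hw Pnb).
    by case: b {Pb Pnb}.
  move=> /negP nhw; have ends : height w <= t -> t' <= height w -> False.
    by move=> h1 h2; apply: nhw; rewrite (le_trans tt' h2) (le_trans h1 tt').
  have bb (c : bool) : c = b -> c = ~~ b -> False by move=> ->; case: (b).
  move: Pb Pnb => [[[//]|[h1 e1]]|[h1 e1]] [[[//]|[h2 e2]]|[h2 e2]].
  - exact: bb e1 e2.
  - exact: ends h1 h2.
  - exact: ends h2 h1.
  - exact: bb e1 e2.
have Ptot b w : P b w \/ P (~~ b) w.
  have btot (c : bool) : c = b \/ c = ~~ b by case: c b => [] []; [left|right|right|left].
  have [h1|/ltW h1] := leP t (height w); last first.
    by have [] := btot d => e; [left|right]; left; right.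
  have [h2|/ltW h2] := leP (height w) t'; last first.
    by have [] := btot d' => e; [left|right]; right.
  by have [] := btot (digit D (fibre w) N) => e; [left|right]; left; left; split => //; rewrite h1.
pose b := digit D (fibre u) N.
(* [C b] is relatively clopen in the connected set [K] and contains the image of [u], hence also
   that of [v]. *)
have KC : K `&` C b = K.
  apply: cK.
  - by exists (laakso_pi u); split => //; apply/CP; left; left.
  - exists (~` C (~~ b)); first exact: closed_openC.
    apply/seteqP; split => z [Kz]; rewrite -[z]laakso_pi_repr in Kz *.
      by move=> /CP Cz; split => // /CP; exact: Pex Cz.
    move=> nC; split => //; apply/CP; case: (Ptot b (repr z)) => // Cz.
    by exfalso; apply: nC; apply/CP.
  - by exists (C b).
apply: uv; apply/esym; apply: Pdigit => //; apply/CP.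
by have [] : (K `&` C b) (laakso_pi v) by rewrite KC.
Qed.

End cutting.

(** * Total diameter of a cover, counted with multiplicity over heights *)

Section covering.
Context {R : realType}.
Local Notation mu := (@lebesgue_measure R).

(** The interval from the infimum to the supremum of the heights in [U] works; the bound [delta]
    makes the diameter finite. *)
Lemma height_hull (U : set (R * R)) (delta : R) : (diameter U <= delta%:E)%E ->
  exists I : set R, [/\ measurable I, (mu I <= diameter U)%E & forall p, U p -> I p.2].
Proof.
move=> Ud; have [->|/set0P[p0 Up0]] := eqVneq U set0.
  by exists set0; split => //; rewrite measure0 diameter_ge0.
have Ufin : diameter U \is a fin_num.
  by rewrite ge0_fin_numE ?diameter_ge0// (le_lt_trans Ud)// ltry.
pose r := fine (diameter U).
have rE : diameter U = r%:E by rewrite fineK.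
have close p q : U p -> U q -> p.2 - q.2 <= r.
  move=> Up Uq; have := euclidean_dist_le_diameter Up Uq; rewrite rE lee_fin.
  by apply: le_trans; apply: le_trans (euclidean_dist_ge2 p q); exact: ler_norm.
pose V := snd @` U.
have V0 : V !=set0 by exists p0.2, p0.
have Vub : has_ubound V.
  by exists (p0.2 + r) => _ [p Up <-]; rewrite -lerBlDl; exact: close.
have Vlb : has_lbound V.
  by exists (p0.2 - r) => _ [p Up <-]; rewrite lerBlDr -lerBlDl; exact: close.
exists `[inf V, sup V]%classic; split => //.
- rewrite lebesgue_measure_itv/= lte_fin; case: ifPn => // _; last exact: diameter_ge0.
  rewrite rE -EFinB lee_fin lerBlDr; apply: sup_le_ub => // _ [p Up <-].
  rewrite -lerBlDl; apply: lb_le_inf => // _ [q Uq <-].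
  by rewrite lerBlDr -lerBlDl; exact: close.
- move=> p Up /=; rewrite in_itv/=; apply/andP; split.
  + by apply: ge_inf => //; exists p.
  + by apply: sup_ubound => //; exists p.
Qed.

Lemma indic_series_ge1 (I : nat -> set R) t i : I i t ->
  (1 <= \sum_(0 <= k <oo) (\1_(I k) t : R)%:E)%E.
Proof.
move=> Ii; have := @lee_sum_fset_lim R (fun k => (\1_(I k) t : R)%:E) [fset i]%fset xpredT.
rewrite big_seq_fset1 indicE mem_set//; move=> h.
by apply: h => k _; rewrite lee_fin.
Qed.

Lemma indic_series_ge2 (I : nat -> set R) t i j : i != j -> I i t -> I j t ->
  (1 + 1 <= \sum_(0 <= k <oo) (\1_(I k) t : R)%:E)%E.
Proof.
move=> ij Ii Ij; have := @lee_sum_fset_lim R (fun k => (\1_(I k) t : R)%:E) [fset i; j]%fset xpredT.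
rewrite big_fsetU1 ?inE//= big_seq_fset1 !indicE !mem_set//; move=> h.
by apply: h => k _; rewrite lee_fin.
Qed.

Lemma measure_setD_countable (A E : set R) : measurable A -> countable E ->
  mu (A `\` E) = mu A.
Proof.
move=> mA cE; have mE : measurable E by exact: countable_measurable.
rewrite (measureDI mu mA mE) [X in (_ + X)%E](_ : _ = 0%E) ?adde0//.
apply: countable_lebesgue_measure0; apply: sub_countable cE.
by apply: subset_card_le; exact: subIsetr.
Qed.

(** Replace each [U i] by its interval of heights and integrate over [t] the number of intervals
    containing [t]. Outside of [E] it is at least 1 on []c1, c4[], and at least 2 on the two outer
    intervals, where points of [G] more than [delta] apart cannot share a set [U i]. *)
Lemma diameter_sum_ge (G : set (R * R)) (U : nat -> set (R * R)) (E : set R)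
    (delta c1 c2 c3 c4 : R) :
  G `<=` \bigcup_i U i -> (forall i, (diameter (U i) <= delta%:E)%E) ->
  countable E -> c1 <= c2 -> c2 <= c3 -> c3 <= c4 ->
  (forall t, ~ E t -> t \in `]c1, c4[ -> exists2 p, G p & p.2 = t) ->
  (forall t, ~ E t -> t \in `]c1, c2[%R \/ t \in `]c3, c4[%R ->
    exists p q, [/\ G p, G q, p.2 = t, q.2 = t & delta < `|p.1 - q.1|]) ->
  ((2 * (c4 - c1) - (c3 - c2))%:E <= \sum_(0 <= i <oo) diameter (U i))%E.
Proof.
move=> GU Ud cE c12 c23 c34 one two.
have /choice[I IP] := fun i => height_hull (Ud i).
have mI i : measurable (I i) by have [] := IP i.
pose A := `]c1, c4[%classic `\` E; pose B := `]c1, c2[%classic `\` E.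
pose C := `]c3, c4[%classic `\` E.
have mE : measurable E by exact: countable_measurable.
have mA : measurable A by exact: measurableD.
have mB : measurable B by exact: measurableD.
have mC : measurable C by exact: measurableD.
have mu_itv (x y : R) : x <= y -> mu (`]x, y[%classic `\` E) = (y - x)%:E.
  move=> xy; rewrite measure_setD_countable// lebesgue_measure_itv/= lte_fin.
  by case: ltgtP xy => // ->; rewrite subrr.
have mind (S : set R) : measurable S -> measurable_fun setT (fun t : R => (\1_S t : R)%:E).
  by move=> mS; apply/measurable_EFinP.
(* The bound is [(c4 - c1) + (c2 - c1) + (c4 - c3)]: the outer intervals are counted once more. *)
have -> : ((2 * (c4 - c1) - (c3 - c2))%:E = mu A + (mu B + mu C))%E.
  rewrite /A /B /C !mu_itv//; last by rewrite (le_trans c12)// (le_trans c23).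
  by rewrite -!EFinD; congr EFin; ring.
have -> : (mu A + (mu B + mu C))%E =
    (\int[mu]_t ((\1_A t : R)%:E + ((\1_B t : R)%:E + (\1_C t : R)%:E)))%E.
  rewrite ge0_integralD//; last 3 first.
  - exact: mind.
  - by move=> t _; rewrite adde_ge0.
  - by apply: emeasurable_funD; exact: mind.
  rewrite ge0_integralD//; [|exact: mind|exact: mind].
  by rewrite !integral_indic// !setIT.
apply: (@le_trans _ _ (\sum_(0 <= i <oo) mu (I i))%E); last first.
  by apply: lee_nneseries => i _ //; have [] := IP i.
have -> : (\sum_(0 <= i <oo) mu (I i) = \sum_(0 <= i <oo) \int[mu]_t (\1_(I i) t : R)%:E)%E.
  by apply: eq_eseriesr => i _; rewrite (integral_indic mu measurableT (mI i)) setIT.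
rewrite -integral_nneseries//; last by move=> i; exact: mind.
apply: ge0_le_integral => //.
- by move=> t _; rewrite !adde_ge0.
- by apply: emeasurable_funD; [|apply: emeasurable_funD]; exact: mind.
- by apply: ge0_emeasurable_sum => // i _; exact: mind.
move=> t _.
have hit p : G p -> exists2 i, U i p & I i p.2.
  by move=> /GU[i _ Ui]; exists i => //; have [_ _] := IP i; exact.
have [At|nAt] := pselect (A t); last first.
  rewrite !indicE !memNset//.
  + by rewrite !adde0; apply: nneseries_ge0 => i _ _; rewrite lee_fin.
  + move=> [/= tI nE]; apply: nAt; split => //; move: tI; rewrite /= !in_itv/= => /andP[h1 h2].
    by rewrite h2 (le_lt_trans _ h1)// (le_trans c12).
  + move=> [/= tI nE]; apply: nAt; split => //; move: tI; rewrite /= !in_itv/= => /andP[h1 h2].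
    by rewrite h1 (lt_le_trans h2)// (le_trans c23).
have nE : ~ E t by case: At.
have [BCt|nBC] := pselect (t \in `]c1, c2[%R \/ t \in `]c3, c4[%R).
- have [p [q [Gp Gq pt qt pq]]] := two _ nE BCt.
  have [i Ui Ii] := hit _ Gp; have [j Uj Ij] := hit _ Gq.
  rewrite pt in Ii; rewrite qt in Ij.
  have ij : i != j.
    apply/eqP => ij; rewrite -ij in Uj.
    have := le_trans (euclidean_dist_le_diameter Ui Uj) (Ud i).
    rewrite lee_fin => /(le_trans (euclidean_dist_ge1 p q)).
    by rewrite leNgt pq.
  apply: le_trans (indic_series_ge2 ij Ii Ij); rewrite leeD//.
    by rewrite indicE; case: (_ \in _).
  have [tB|tB] := pselect (B t).
    rewrite [X in (_ + X)%E](_ : _ = 0%E) ?adde0; first by rewrite indicE; case: (_ \in _).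
    rewrite indicE memNset// => -[/= tC _]; case: tB => /= tB _.
    move: tB tC; rewrite !in_itv/= => /andP[_ h1] /andP[h2 _].
    by move: (lt_trans h2 h1); rewrite ltNge c23.
  rewrite indicE memNset// add0e indicE; case: (_ \in _) => //.
- have [p Gp pt] := one _ nE At.1.
  have [i Ui Ii] := hit _ Gp; rewrite pt in Ii.
  apply: le_trans (indic_series_ge1 Ii).
  rewrite !indicE (mem_set At) !memNset ?adde0//.
  + by move=> [tC _]; apply: nBC; right.
  + by move=> [tB _]; apply: nBC; left.
Qed.

End covering.

(** * The lower bound for the length of a lift *)

Section lower_bound.
Context {R : realType} (D : laakso_data R).
Local Notation X := (set_type (pre_laakso D)).
Implicit Types (u v w : X) (K : set (laakso D)) (t : R).

Lemma laakso_height_continuous : continuous (@laakso_height R D).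
Proof.
apply/quotient_continuous; rewrite (_ : _ \o _ = @height R D).
  exact: height_continuous.
by apply/funext => w; exact: laakso_height_pi.
Qed.

Lemma connected_height K u v t : connected K ->
  K (laakso_pi u) -> K (laakso_pi v) -> height u <= t <= height v ->
  exists2 w, K (laakso_pi w) & height w = t.
Proof.
move=> cK Ku Kv ht.
have : connected (@laakso_height R D @` K).
  apply: connected_continuous_connected => //.
  exact/continuous_subspaceT/laakso_height_continuous.
move=> /connected_intervalP /(_ (height u) (height v)) H.
have [||z Kz zt] := H _ _ _ ht.
- by exists (laakso_pi u) => //; rewrite laakso_height_pi.
- by exists (laakso_pi v) => //; rewrite laakso_height_pi.
by exists (repr z); rewrite ?laakso_pi_repr.
Qed.

Lemma not_unseparated K k t : ~ unseparated K k t ->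
  exists w w', [/\ height w = t, height w' = t, K (laakso_pi w), K (laakso_pi w') &
    (s D - 2) / s D ^+ k <= `|fibre w - fibre w'|].
Proof.
move=> nu; apply: contrapT => H; apply: nu => w w' hw hw' Kw Kw' N Nk.
apply: (digit_gap (fibre_F w) (fibre_F w') _ Nk).
by rewrite ltNge; apply/negP => ww'; apply: H; exists w, w'.
Qed.

(** Away from all wormhole levels a gluing class is a single point, so a lift has no choice
    there. *)
Lemma lift_off_J (G : set X) w : (@laakso_pi R D @` G) (laakso_pi w) ->
  ~ (\bigcup_k J D k) (height w) -> G w.
Proof.
move=> [g Gg /laakso_piP /asboolP[<-//|[hgw [k [Jk _]]]]] nJ.
by exfalso; apply: nJ; exists k => //; rewrite -hgw.
Qed.

Section covered_twice.
Variables (u v : X) (K : set (laakso D)).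
Hypotheses (cK : connected K) (Ku : K (laakso_pi u)) (Kv : K (laakso_pi v)).
Hypothesis huv : height u <= height v.
Variable k : nat.

Let T : set R := [set t : R | t <= height u /\ unseparated K k t].
Let S : set R := [set t : R | height v <= t /\ unseparated K k t].
(* The supremum is at least 0 and the infimum at most 1, since a height outside
   of [[0, 1]] is unseparated. *)
Definition lower_cut : R := sup T.
Definition upper_cut : R := inf S.

Let has_sup_T : has_sup T.
Proof.
split; last by exists (height u) => t [].
exists (- 1); split.
  by have /andP[h _] := height_itv u; rewrite (le_trans _ h)// lerN10.
move=> w w' hw; have /andP[] := height_itv w.
by rewrite hw ler0N1.
Qed.

Let has_inf_S : has_inf S.
Proof.
split; last by exists (height v) => t [].
exists 2; split.
  by have /andP[_ h] := height_itv v; rewrite (le_trans h)// ler1n.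
move=> w w' hw; have /andP[_] := height_itv w.
by rewrite hw leNgt ltr1n.
Qed.

Let lo_le : lower_cut <= height u.
Proof. by apply: sup_le_ub => [|t []//]; case: has_sup_T. Qed.

Let hi_ge : height v <= upper_cut.
Proof. by apply: lb_le_inf => [|t []//]; case: has_inf_S. Qed.

(** By definition of the cuts, no height strictly between [lower_cut] and [height u], or between
    [height v] and [upper_cut], is unseparated; off the wormhole levels the lift has two points
    there, a digit gap apart. In between, connectedness provides one. *)
Lemma lift_length_ge_unseparated (G : set X) : @laakso_pi R D @` G = K ->
  ((2 * (upper_cut - lower_cut) - (height v - height u))%:E <= lift_length G)%E.
Proof.
(* Half of the digit gap, so that separated points are strictly more than [delta] apart. *)
move=> GK; pose delta := (s D - 2) / s D ^+ k / 2.
have gap0 := digit_gap_gt0 D k.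
have delta0 : 0 < delta by rewrite divr_gt0.
have delta_lt : delta < (s D - 2) / s D ^+ k.
  by rewrite /delta ltr_pdivrMr// ltr_pMr// ltr1n.
apply: (@le_trans _ _ (hausdorff1_pre delta (val @` G))); last first.
  by apply: ereal_sup_ubound; exists delta.
apply: le_ereal_inf_tmp => _ [U [GU Ud] <-].
have KG w : K (laakso_pi w) -> ~ (\bigcup_k J D k) (height w) -> (val @` G) (val w).
  by rewrite -GK => Kw nJ; exists w => //; exact: lift_off_J nJ.
have two t : ~ (\bigcup_k J D k) t ->
    t \in `]lower_cut, height u[%R \/ t \in `]height v, upper_cut[%R ->
    exists p q, [/\ (val @` G) p, (val @` G) q, p.2 = t, q.2 = t & delta < `|p.1 - q.1|].
  move=> nJ tI; have nut : ~ unseparated K k t.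
    case: tI; rewrite in_itv/= => /andP[h1 h2] ut.
    - have : t <= lower_cut by apply: sup_ubound; [case: has_sup_T|split => //; exact: ltW].
      by rewrite leNgt h1.
    - have : upper_cut <= t by apply: ge_inf; [case: has_inf_S|split => //; exact: ltW].
      by rewrite leNgt h2.
  have [w [w' [hw hw' Kw Kw' ww']]] := not_unseparated nut.
  exists (val w), (val w'); split => //.
  - by apply: KG => //; rewrite hw.
  - by apply: KG => //; rewrite hw'.
  - exact: lt_le_trans ww'.
apply: (diameter_sum_ge GU Ud (countable_J D) lo_le huv hi_ge _ two).
move=> t nJ; rewrite in_itv/= => /andP[h1 h2].
have [tu|tu] := ltP t (height u).
  have [|p [q [Gp _ pt _ _]]] := two _ nJ; last by exists p.
  by left; rewrite in_itv/= h1.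
have [tv|tv] := ltP (height v) t.
  have [|p [q [Gp _ pt _ _]]] := two _ nJ; last by exists p.
  by right; rewrite in_itv/= tv.
have [|w Kw hw] := connected_height cK Ku Kv (t := t); first by rewrite tu.
by exists (val w) => //; apply: KG => //; rewrite hw.
Qed.

(** The interval from [lower_cut - r] to [upper_cut + r], clipped to [[0, 1]], is admissible: levels
    of index below [k] are met by cutting, the others by density. *)
Lemma minimal_le_unseparated (a b r : R) : minimal_height_interval u v a b ->
  0 < r <= 1 / 2 ->
  (forall N (c : R), (k <= N)%N -> 0 <= c -> c + r <= 1 -> `[c, c + r] `&` J D N !=set0) ->
  b - a <= upper_cut - lower_cut + 2 * r.
Proof.
move=> [_ abmin] /andP[r0 r1] dense.
have /andP[u0 u1] := height_itv u; have /andP[v0 v1] := height_itv v.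
have := lo_le; have := hi_ge => hi_v lo_u.
have u_hi : height u <= upper_cut by exact: le_trans hi_v.
have lo_v : lower_cut <= height v by exact: le_trans lo_u huv.
have lo_hi : lower_cut <= upper_cut by apply: le_trans hi_v; exact: le_trans huv.
apply: (@le_trans _ _ (Num.min 1 (upper_cut + r) - Num.max 0 (lower_cut - r))); last first.
  have h1 : Num.min 1 (upper_cut + r) <= upper_cut + r by rewrite ge_min lexx orbT.
  have h2 : lower_cut - r <= Num.max 0 (lower_cut - r) by rewrite le_max lexx orbT.
  by lra.
have inI (x : R) : 0 <= x <= 1 -> lower_cut - r <= x <= upper_cut + r ->
    x \in `[Num.max 0 (lower_cut - r), Num.min 1 (upper_cut + r)].
  by move=> /andP[x0 x1] /andP[x2 x3]; rewrite in_itv/= ge_max le_min x0 x1 x2 x3.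
apply: abmin; split.
- by rewrite le_max lexx ge_min lexx.
- by apply: inI; apply/andP; split; lra.
- by apply: inI; apply/andP; split; lra.
move=> N reqN; have [Nk|kN] := ltnP N k.
(* The supremum and the infimum need not be attained; the margin [r] leaves room for unseparated
   heights near them. *)
- have [t [tu ut] tlo] := sup_adherent r0 has_sup_T.
  have [t' [vt' ut'] t'upper_cut] := inf_adherent r0 has_inf_S.
  have [||z [zt Jz]] := unseparated_meets_J cK Ku Kv _ _ ut ut' Nk reqN.
  + by rewrite tu (le_trans huv).
  + by rewrite vt' (le_trans tu).
  exists z; split => //; apply: inI.
    have [A AM ->] := J_ratio Jz.
    by rewrite divr_ge0//= ler_pdivrMr ?mul1r ?ler_nat 1?ltnW// ltr0n mprod_gt0.
  move: zt; rewrite /= in_itv/= => /andP[z1 z2].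
  by rewrite -/lower_cut -/upper_cut in tlo t'upper_cut; apply/andP; split; lra.
(* The interval of length [r] is placed below [height u] if there is room, and otherwise above it,
   where [height u + r < 2 * r <= 1]. *)
- have [ru|ur] := leP r (height u).
  + have [||z [zI Jz]] := dense N (height u - r) kN; [lra|lra|].
    exists z; split => //; move: zI; rewrite /= in_itv/= => /andP[z1 z2].
    by apply: inI; apply/andP; split; lra.
  + have [||z [zI Jz]] := dense N (height u) kN; [lra|lra|].
    exists z; split => //; move: zI; rewrite /= in_itv/= => /andP[z1 z2].
    by apply: inI; apply/andP; split; lra.
Qed.

End covered_twice.

Lemma lift_length_ge u v K (G : set X) (a b : R) : connected K ->
  K (laakso_pi u) -> K (laakso_pi v) -> height u <= height v ->
  @laakso_pi R D @` G = K -> minimal_height_interval u v a b ->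
  ((2 * (b - a) - (height v - height u))%:E <= lift_length G)%E.
Proof.
move=> cK Ku Kv huv GK hab; apply/lee_addgt0Pr => e e0.
(* The margin [r] is added at both ends and the interval counts twice, hence [e / 4]; the scale [k]
   is chosen after [r]. *)
pose r := Num.min (e / 4) (1 / 2).
have r0 : 0 < r by rewrite lt_min !divr_gt0.
have r1 : r <= 1 / 2 by rewrite ge_min lexx orbT.
have re : r <= e / 4 by rewrite ge_min lexx.
have [k dense] := J_dense D r0.
have := minimal_le_unseparated cK Ku Kv huv hab (k := k) (r := r).
rewrite r0 r1 => /(_ isT dense) h.
have := lift_length_ge_unseparated cK Ku Kv huv k GK.
move=> /(leeD2r e%:E); apply: le_trans.
rewrite -EFinD lee_fin; lra.
Qed.

End lower_bound.

(** * Comparison of an associated path with an arbitrary path *)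

Lemma minimal_height_interval_sym (R : realType) (D : laakso_data R)
    (u v : set_type (pre_laakso D)) (a b : R) :
  minimal_height_interval u v a b -> minimal_height_interval v u a b.
Proof.
have sym u1 v1 a1 b1 : @admissible_interval R D u1 v1 a1 b1 -> admissible_interval v1 u1 a1 b1.
  by move=> [ab1 hu hv H]; split => // N /nesym; exact: H.
by move=> [ab abmin]; split => [|a' b' /sym]; [exact: sym|exact: abmin].
Qed.

(** The number [2 * (b - a) - (height v - height u)] lies between the two lengths. *)
Lemma associated_from_le_dist (R : realType) (D : laakso_data R)
    (u v : set_type (pre_laakso D)) (a b : R) (p : R -> laakso D)
    (G : set (set_type (pre_laakso D))) (K : set (laakso D))
    (G' : set (set_type (pre_laakso D))) :
  minimal_height_interval u v a b -> height u <= height v ->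
  associated_from u v a b p G ->
  connected K -> K (laakso_pi u) -> K (laakso_pi v) -> @laakso_pi R D @` G' = K ->
  (lift_length G <= lift_length G')%E.
Proof.
move=> hab huv hp cK Ku Kv GK.
apply: le_trans (lift_length_ge cK Ku Kv huv GK hab).
case: hab => -[_ hu hv _] _; move: hu hv; rewrite !in_itv/= => /andP[au _] /andP[_ vb].
exact: associated_from_length hp.
Qed.

Theorem theorem3p18 (R : realType) (D : laakso_data R) (x y : laakso D)
    (u v : set_type (pre_laakso D)) (a b : R)
    (xE : x = laakso_pi u) (yE : y = laakso_pi v)
    (hab : minimal_height_interval u v a b)
    (p : R -> laakso D) (G : set (set_type (pre_laakso D)))
    (hp : associated_path u v a b p G) :
  lift_length G = laakso_dist x y.
Proof.
case: hp => pP pG assoc; apply/eqP; rewrite eq_le; apply/andP; split; last first.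
  by apply: ereal_inf_lbound; exists G => //; exists p => //; rewrite xE yE.
apply: le_ereal_inf_tmp => _ [G' [q [cq q0 q1] qG'] <-].
have cK : connected (q @` `[0, 1]).
  exact: connected_continuous_connected (@segment_connected R 0 1) cq.
have Ku : (q @` `[0, 1]) (laakso_pi u).
  by exists 0; [rewrite /= in_itv/= lexx ler01|rewrite q0].
have Kv : (q @` `[0, 1]) (laakso_pi v).
  by exists 1; [rewrite /= in_itv/= lexx ler01|rewrite q1].
case: assoc => -[huv H].
- exact: associated_from_le_dist hab huv H cK Ku Kv qG'.
(* The roles of [u] and [v] are exchanged; reversing time does not change the lift [G]. *)
- exact: associated_from_le_dist (minimal_height_interval_sym hab) (ltW huv) H cK Kv Ku qG'.
Qed.
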